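(* Let $X$ be a set and let $M(X)$ be the join semilattice of coarse equivalence classes of uniformly discrete metrics on $X$. For any ideal $F$ of $M(X)$, one has $C^*_u(X,F)=C^*_u(X,\Phi(F))$, where $C^*_u(X,F)$ is the generalized uniform Roe algebra of the ideal $F$ and $C^*_u(X,\Phi(F))$ is the uniform Roe algebra of the coarse structure $\Phi(F)$ generated by all $\mathcal E_d$ with $[d]\in F$.
   Context: Two metrics $d_1,d_2$ on $X$ are coarsely equivalent, $d_1\sim d_2$, if there is a monotone function $\varphi:[0,\infty)\to[0,\infty)$ with $\lim_{t\to\infty}\varphi(t)=\infty$ such that $d_1(x,y)\le\varphi(d_2(x,y))$ and $d_2(x,y)\le\varphi(d_1(x,y))$ for all $x,y\in X$. A metric $d$ is uniformly discrete if there is $r>0$ with $d(x,y)\ge r$ for all $x\ne y$. $\mathcal M(X)$ is the set of uniformly discrete metrics on $X$, $M(X)=\mathcal M(X)/\sim$, and $[a]$ is the class of $a$. For $a,b\in\mathcal M(X)$, $(a\lor b)(x,y)=\inf\sum_{i=1}^n\min(a(x_{i-1},x_i),b(x_{i-1},x_i))$, the infimum being over all finite sequences $x=x_0,x_1,\ldots,x_n=y$ in $X$. The join on $M(X)$ is $[a]\lor[b]=[a\lor b]$, and $\alpha\preceq\beta$ in $M(X)$ means $\alpha\lor\beta=\beta$; equivalently, $[a]\preceq[b]$ iff there is a homeomorphism $\varphi$ of $[0,\infty)$ with $b(x,y)\le\varphi(a(x,y))$ for all $x,y\in X$. An ideal of $M(X)$ is a subset $F\subset M(X)$ that is downwards closed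 ($\alpha\preceq\beta$, $\beta\in F$ imply $\alpha\in F$) and closed under joins ($\alpha,\beta\in F$ implies $\alpha\lor\beta\in F$). A coarse structure on $X$ is a family $\mathcal E$ of subsets of $X\times X$ containing the diagonal and closed under taking subsets, finite unions, inverses $E^{-1}=\{(y,x):(x,y)\in E\}$, and finite compositions $E\circ G=\{(x,z):(x,y)\in E,\ (y,z)\in G\text{ for some }y\in X\}$. For a metric $d$, put $E_R(d)=\{(x,y)\in X\times X:d(x,y)\le R\}$; $\mathcal E_d$ is the coarse structure consisting of all $E\subset X\times X$ with $E\subset E_R(d)$ for some $R>0$. It depends only on $\alpha=[d]$ and is also denoted $\mathcal E_\alpha$. Let $\{\delta_x\}_{x\in X}$ be the standard basis of $l_2(X)$. For a coarse structure $\mathcal E$, the uniform Roe algebra $C^*_u(X,\mathcal E)\subset\mathbb B(l_2(X))$ is the $C^*$-algebra generated by (i.e. the norm closure of the algebra of) bounded operators $T$ for which there is $E\in\mathcal E$ with $T_{xy}=\langle\delta_x,T\delta_y\rangle=0$ for all $(x,y)\notin E$. For $\alpha\in M(X)$, $C^*_u(X,\alpha)=C^*_u(X,\mathcal E_\alpha)$. If $\alpha\preceq\beta$ then $C^*_u(X,\alpha)\subset C^*_u(X,\beta)$. An ideal $F$ is directed by $\preceq$, and $C^*_u(X,F)=\varinjlim_{\alpha\in F}C^*_u(X,\alpha)$ is the direct limit along these inclusions, identified with the norm closure of $\bigcup_{\alpha\in F}C^*_u(X,\alpha)$ in $\mathbb B(l_2(X))$. *)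

(* Defs.v *)
From HB Require Import structures.
From mathcomp Require Import all_boot all_order all_algebra.
From mathcomp Require Import generic_quotient.
From mathcomp Require Import all_classical all_reals all_analysis.
From mathcomp Require Import complex ring lra.

Set Implicit Arguments.
Unset Strict Implicit.
Unset Printing Implicit Defensive.

Import Order.TTheory GRing.Theory Num.Theory.
Import numFieldNormedType.Exports.

Local Open Scope classical_set_scope.
Local Open Scope ring_scope.
Local Open Scope quotient_scope.

(** * Uniformly discrete metrics and coarse equivalence *)

Definition is_metric (R : realType) (X : Type) (d : X -> X -> R) : Prop :=
  [/\ forall x y, 0 <= d x y,
      forall x y, d x y = 0 <-> x = y,
      forall x y, d x y = d y x &
      forall x y z, d x z <= d x y + d y z].

Definition uniformly_discrete (R : realType) (X : Type) (d : X -> X -> R) :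
    Prop :=
  exists2 r : R, 0 < r & forall x y, x <> y -> r <= d x y.

Record udmetric (R : realType) (X : Type) := UDMetric {
  udist :> X -> X -> R;
  udist_metric : is_metric udist;
  udist_discrete : uniformly_discrete udist }.

HB.instance Definition _ (R : realType) (X : Type) :=
  gen_eqMixin (udmetric R X).
HB.instance Definition _ (R : realType) (X : Type) :=
  gen_choiceMixin (udmetric R X).

(* Monotone functions [0, oo) -> [0, oo) tending to oo; the values at negative
   reals are irrelevant. *)
Definition control (R : realType) (phi : R -> R) : Prop :=
  [/\ forall s t, 0 <= s -> s <= t -> phi s <= phi t,
      forall t, 0 <= t -> 0 <= phi t &
      phi t @[t --> +oo] --> +oo].

Definition coarse_equiv (R : realType) (X : Type) (d1 d2 : X -> X -> R) :
    Prop :=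
  exists2 phi : R -> R, control phi &
    forall x y, d1 x y <= phi (d2 x y) /\ d2 x y <= phi (d1 x y).

Definition coarse_le (R : realType) (X : Type) (d1 d2 : X -> X -> R) : Prop :=
  exists f : R -> R,
    [/\ forall s t, 0 <= s -> s <= t -> f s <= f t,
        forall t, 0 <= t -> 0 <= f t &
        forall x y, d1 x y <= f (d2 x y)].

Lemma coarse_equivP (R : realType) (X : Type) (d1 d2 : udmetric R X) :
  coarse_equiv d1 d2 <-> coarse_le d1 d2 /\ coarse_le d2 d1.
Proof.
split=> [[phi [mphi pphi _] H]|[[f [mf pf Hf]] [g [mg pg Hg]]]].
  by split; exists phi; split=> // x y; have [] := H x y.
have [p1 _ _ _] := udist_metric d1; have [p2 _ _ _] := udist_metric d2.
exists (fun t => f t + g t + `|t|).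
  split.
  - move=> s t s0 st; have := mf _ _ s0 st; have := mg _ _ s0 st.
    by rewrite !ger0_norm// ?(le_trans s0 st)//; lra.
  - by move=> t t0; rewrite !addr_ge0// ?pf ?pg.
  - apply/cvgryPge => A; near=> t.
    have t0 : 0 <= t by near: t; apply: nbhs_pinfty_ge; rewrite num_real.
    have tA : A <= t by near: t; apply: nbhs_pinfty_ge; rewrite num_real.
    have := pf _ t0; have := pg _ t0; rewrite ger0_norm//; lra.
move=> x y; split.
- have := Hf x y; have := pg _ (p2 x y); have := normr_ge0 (d2 x y); lra.
- have := Hg x y; have := pf _ (p1 x y); have := normr_ge0 (d1 x y); lra.
Unshelve. all: by end_near. Qed.

Lemma coarse_le_refl (R : realType) (X : Type) (d : udmetric R X) :
  coarse_le d d.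
Proof. by exists id; split. Qed.

Lemma coarse_le_trans (R : realType) (X : Type) (d1 d2 d3 : udmetric R X) :
  coarse_le d1 d2 -> coarse_le d2 d3 -> coarse_le d1 d3.
Proof.
have [p2 _ _ _] := udist_metric d2.
move=> [f [mf pf Hf]] [g [mg pg Hg]]; exists (f \o g); split => /=.
- by move=> s t s0 st; apply: mf; [exact: pg|exact: mg].
- by move=> t t0; apply: pf; exact: pg.
- by move=> x y; apply: (le_trans (Hf x y)); apply: mf.
Qed.

Definition coarse_equivb (R : realType) (X : Type) (a b : udmetric R X) :
    bool :=
  `[< coarse_equiv a b >].

Lemma coarse_equivb_refl (R : realType) (X : Type) :
  reflexive (@coarse_equivb R X).
Proof. by move=> a; apply/asboolP/coarse_equivP; split; exact: coarse_le_refl. Qed.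

Lemma coarse_equivb_sym (R : realType) (X : Type) :
  symmetric (@coarse_equivb R X).
Proof.
by move=> a b; apply/asboolP/asboolP => /coarse_equivP[? ?];
  apply/coarse_equivP.
Qed.

Lemma coarse_equivb_trans (R : realType) (X : Type) :
  transitive (@coarse_equivb R X).
Proof.
move=> b a c /asboolP/coarse_equivP[ab ba] /asboolP/coarse_equivP[bc cb].
by apply/asboolP/coarse_equivP; split; apply: coarse_le_trans; eassumption.
Qed.

Canonical coarse_equiv_rel (R : realType) (X : Type) :=
  EquivRel (@coarse_equivb R X) (@coarse_equivb_refl R X)
    (@coarse_equivb_sym R X) (@coarse_equivb_trans R X).

Definition coarse_class (R : realType) (X : Type) :=
  {eq_quot (coarse_equiv_rel R X)}.

HB.instance Definition _ (R : realType) (X : Type) :=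
  EqQuotient.on (coarse_class R X).
HB.instance Definition _ (R : realType) (X : Type) :=
  Choice.on (coarse_class R X).

Definition cclass (R : realType) (X : Type) (a : udmetric R X) :
  coarse_class R X := \pi a.

Lemma cclassP (R : realType) (X : Type) (a b : udmetric R X) :
  cclass a = cclass b <-> coarse_equiv a b.
Proof. by split=> [/eqmodP/asboolP|ab]; [|apply/eqmodP/asboolP]. Qed.

Lemma repr_cclass (R : realType) (X : Type) (al : coarse_class R X) :
  cclass (repr al) = al.
Proof. exact: reprK. Qed.

(** * Joins *)

(* The length of the chain x, x_1, ..., x_n with p = [:: x_1; ...; x_n]. The
   empty p is a chain only from x to itself, where it has the same length 0 as
   p = [:: x]. *)
Definition chain_sum (R : realType) (X : Type) (a b : X -> X -> R) (x : X)
    (p : seq X) : R :=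
  \sum_(t <- pairmap (fun u v => Num.min (a u v) (b u v)) x p) t.

Definition join_dist (R : realType) (X : Type) (a b : X -> X -> R) (x y : X) :
    R :=
  inf [set chain_sum a b x p | p in [set p | last x p = y]].

Section JoinDist.
Context (R : realType) (X : Type) (a b : udmetric R X).

Let m u v := Num.min (a u v) (b u v).

Lemma chain_sum_nil x : chain_sum a b x [::] = 0.
Proof. by rewrite /chain_sum big_nil. Qed.

Lemma chain_sum_cons x y p :
  chain_sum a b x (y :: p) = m x y + chain_sum a b y p.
Proof. by rewrite /chain_sum /= big_cons. Qed.

Lemma chain_sum_cat x p q :
  chain_sum a b x (p ++ q) = chain_sum a b x p + chain_sum a b (last x p) q.
Proof. by rewrite /chain_sum pairmap_cat big_cat. Qed.

Lemma step_ge0 x y : 0 <= m x y.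
Proof.
have [pa _ _ _] := udist_metric a; have [pb _ _ _] := udist_metric b.
by rewrite /m le_min pa pb.
Qed.

Lemma chain_sum_ge0 x p : 0 <= chain_sum a b x p.
Proof.
elim: p x => [|y p IH] x; first by rewrite chain_sum_nil.
by rewrite chain_sum_cons addr_ge0// step_ge0.
Qed.

Lemma step_discrete :
  exists2 r : R, 0 < r & forall x y, x <> y -> r <= m x y.
Proof.
have [r r0 Hr] := udist_discrete a; have [s s0 Hs] := udist_discrete b.
exists (Num.min r s); first by rewrite lt_min r0 s0.
move=> x y xy; rewrite /m le_min !ge_min.
by rewrite (Hr _ _ xy) (Hs _ _ xy) orbT.
Qed.

Lemma stepxx x : m x x = 0.
Proof.
have [_ za _ _] := udist_metric a; have [_ zb _ _] := udist_metric b.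
by rewrite /m (za x x).2// (zb x x).2// minxx.
Qed.

Lemma join_dist_le x p : join_dist a b x (last x p) <= chain_sum a b x p.
Proof.
apply: ge_inf; last by exists p.
by exists 0 => _ [q _ <-]; exact: chain_sum_ge0.
Qed.

Lemma join_dist_le_step x y : join_dist a b x y <= m x y.
Proof.
by have := join_dist_le x [:: y]; rewrite chain_sum_cons chain_sum_nil addr0.
Qed.

Lemma le_join_dist x y (c : R) :
  (forall p, last x p = y -> c <= chain_sum a b x p) -> c <= join_dist a b x y.
Proof.
move=> H; apply: lb_le_inf; first by exists (chain_sum a b x [:: y]), [:: y].
by move=> _ [p /H Hp <-].
Qed.

Lemma join_dist_discrete : uniformly_discrete (join_dist a b).
Proof.
have [r r0 Hr] := step_discrete; exists r => // x y xy.
apply: le_join_dist => p; elim: p x xy => [|z p IH] x xy //= lp.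
rewrite chain_sum_cons; have [xz|xz] := pselect (x = z).
  by subst z; rewrite stepxx add0r; exact: IH.
by rewrite -[leLHS]addr0 lerD ?chain_sum_ge0// Hr.
Qed.

Lemma chain_rev x p :
  exists2 q, last (last x p) q = x &
    chain_sum a b (last x p) q = chain_sum a b x p.
Proof.
have [_ _ sa _] := udist_metric a; have [_ _ sb _] := udist_metric b.
elim: p x => [|y p IH] x /=; first by exists [::]; rewrite // !chain_sum_nil.
have [q lq sq] := IH y; exists (q ++ [:: x]); first by rewrite last_cat.
rewrite chain_sum_cat lq !chain_sum_cons chain_sum_nil sq addr0 addrC.
by rewrite /m (sa x) (sb x).
Qed.

Lemma join_dist_metric : is_metric (join_dist a b).
Proof.
have ge0 x y : 0 <= join_dist a b x y.
  by apply: le_join_dist => p _; exact: chain_sum_ge0.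
have sym x y : join_dist a b x y <= join_dist a b y x.
  apply: le_join_dist => p lp; have [q lq <-] := chain_rev y p.
  by rewrite -[in leLHS]lq -lp; exact: join_dist_le.
split => //.
- move=> x y; split=> [J0|<-].
    apply: contrapT => xy; have [r r0 /(_ _ _ xy)] := join_dist_discrete.
    by rewrite J0 leNgt r0.
  by apply/eqP; rewrite eq_le ge0 andbT -[leRHS](stepxx x) join_dist_le_step.
- by move=> x y; apply/eqP; rewrite eq_le !sym.
- move=> x y z; rewrite -lerBlDr; apply: le_join_dist => p lp.
  rewrite lerBlDl -lerBlDr; apply: le_join_dist => q lq.
  rewrite lerBlDr addrC -[in leRHS]lp -chain_sum_cat.
  by rewrite -lq -lp -last_cat; exact: join_dist_le.
Qed.

Definition join_metric : udmetric R X :=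
  UDMetric join_dist_metric join_dist_discrete.

End JoinDist.

Lemma join_coarse_le (R : realType) (X : Type) (a a' b b' : udmetric R X) :
  coarse_le a a' -> coarse_le b b' ->
  coarse_le (join_metric a b) (join_metric a' b').
Proof.
move=> [f [mf pf Hf]] [g [mg pg Hg]].
have [pa' _ _ _] := udist_metric a'; have [pb' _ _ _] := udist_metric b'.
have [pJ' _ _ _] := join_dist_metric a' b'.
have [pJ zJ _ tJ] := join_dist_metric a b.
have [r r0 Hr] := step_discrete a' b'.
pose h K := (f K + g K) / r.
have ph K : 0 <= K -> 0 <= h K.
  by move=> K0; rewrite /h divr_ge0// ?(ltW r0)// addr_ge0 ?pf ?pg.
have mh s t : 0 <= s -> s <= t -> h s <= h t.
  by move=> s0 st; rewrite /h ler_wpM2r ?invr_ge0 ?(ltW r0)// lerD ?mf ?mg.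
have key x p K : chain_sum a' b' x p <= K ->
    join_dist a b x (last x p) <= chain_sum a' b' x p * h K.
  elim: p x => [|y p IH] x /=.
    by move=> _; rewrite chain_sum_nil mul0r (zJ x x).2.
  rewrite chain_sum_cons => sK.
  have m0 := step_ge0 a' b' x y; have s0 := chain_sum_ge0 a' b' y p.
  have K0 : 0 <= K by lra.
  apply: (le_trans (tJ x y _)); rewrite mulrDl lerD// ?IH//; last by lra.
  have [xy|xy] := pselect (x = y).
    by subst y; rewrite (zJ x x).2// mulr_ge0// ph.
  apply: (@le_trans _ _ (r * h K)); last by rewrite ler_wpM2r ?ph// Hr.
  rewrite /h mulrC divfK ?gt_eqF//.
  apply: (le_trans (join_dist_le_step a b x y)).
  have {s0 m0} : Num.min (a' x y) (b' x y) <= K by lra.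
  rewrite ge_min => /orP[aK|bK].
    rewrite ge_min; apply/orP; left; apply: (le_trans (Hf x y)).
    by have := mf _ _ (pa' x y) aK; have := pg _ K0; lra.
  rewrite ge_min; apply/orP; right; apply: (le_trans (Hg x y)).
  by have := mg _ _ (pb' x y) bK; have := pf _ K0; lra.
exists (fun t => (t + 1) * h (t + 1)); split=> [s t s0 st|t t0|x y].
- have s1 : 0 <= s + 1 by lra.
  by rewrite ler_pM ?ph ?mh ?lerD2r.
- by rewrite mulr_ge0 ?ph// addr_ge0.
- rewrite /=.
  have [p lp sp] : exists2 p, last x p = y &
      chain_sum a' b' x p < join_dist a' b' x y + 1.
    apply: contrapT => H.
    have : join_dist a' b' x y + 1 <= join_dist a' b' x y.
      apply: le_join_dist => p lp; rewrite leNgt; apply/negP => sp.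
      by apply: H; exists p.
    lra.
  rewrite -{1}lp; apply: (le_trans (key x p _ (ltW sp))).
  by rewrite ler_wpM2r ?ph ?(ltW sp)// addr_ge0// pJ'.
Qed.

Definition cjoin (R : realType) (X : Type) (al be : coarse_class R X) :
    coarse_class R X :=
  cclass (join_metric (repr al) (repr be)).

Lemma cjoin_cclass (R : realType) (X : Type) (a b : udmetric R X) :
  cjoin (cclass a) (cclass b) = cclass (join_metric a b).
Proof.
apply/cclassP/coarse_equivP.
have /cclassP/coarse_equivP[a1 a2] := repr_cclass (cclass a).
have /cclassP/coarse_equivP[b1 b2] := repr_cclass (cclass b).
by split; apply: join_coarse_le.
Qed.

Definition cle (R : realType) (X : Type) (al be : coarse_class R X) : Prop :=
  cjoin al be = be.

Definition is_ideal (R : realType) (X : Type) (F : set (coarse_class R X)) :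
    Prop :=
  (forall al be, cle al be -> F be -> F al) /\
  (forall al be, F al -> F be -> F (cjoin al be)).

(** * Coarse structures *)

(* In the library, [G \; E] is the set of pairs (x, z) such that (x, y) is in
   E and (y, z) is in G for some y. *)
Definition coarse_structure (X : Type) (E : set (set (X * X))) : Prop :=
  [/\ E diagonal,
      forall A B, A `<=` B -> E B -> E A,
      forall A B, E A -> E B -> E (A `|` B),
      forall A, E A -> E (A^-1)%relation &
      forall A B, E A -> E B -> E (B \; A)%relation].

Definition entourage_le (R : realType) (X : Type) (d : X -> X -> R) (r : R) :
    set (X * X) :=
  [set xy | d xy.1 xy.2 <= r].

Definition metric_coarse (R : realType) (X : Type) (d : X -> X -> R) :
    set (set (X * X)) :=
  [set A | exists2 r : R, 0 < r & A `<=` entourage_le d r].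

Lemma metric_coarse_equiv (R : realType) (X : Type) (a b : udmetric R X) :
  coarse_equiv a b -> metric_coarse a = metric_coarse b.
Proof.
suff sub (c d : udmetric R X) : coarse_le d c ->
    metric_coarse c `<=` metric_coarse d.
  by move=> /coarse_equivP[ab ba]; apply/seteqP; split; exact: sub.
move=> [f [mf pf Hf]] A [r r0 Ar].
have [pc _ _ _] := udist_metric c.
exists (f r + 1); first by have := pf _ (ltW r0); lra.
move=> [x y] /Ar; rewrite /entourage_le /= => cr.
by have := Hf x y; have := mf _ _ (pc x y) cr; lra.
Qed.

Definition class_coarse (R : realType) (X : Type) (al : coarse_class R X) :
    set (set (X * X)) :=
  metric_coarse (repr al).

Lemma class_coarse_cclass (R : realType) (X : Type) (a : udmetric R X) :
  class_coarse (cclass a) = metric_coarse a.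
Proof. by apply: metric_coarse_equiv; apply/cclassP; exact: repr_cclass. Qed.

Definition ideal_coarse (R : realType) (X : Type) (F : set (coarse_class R X)) :
    set (set (X * X)) :=
  smallest (@coarse_structure X)
    (\bigcup_(d in [set d : udmetric R X | F (cclass d)]) metric_coarse d).

(** * The Hilbert space l_2(X) and its bounded operators *)

Definition sqmod (R : realType) (z : R[i]) : \bar R :=
  ((ComplexField.Normc.normc z) ^+ 2)%:E.

Definition l2_pred (R : realType) (X : choiceType) : {pred X -> R[i]} :=
  [pred f : X -> R[i] | `[< summable setT (fun x => sqmod (f x)) >]].

Lemma sqmod_ge0 (R : realType) (z : R[i]) : (0 <= sqmod z)%E.
Proof. by rewrite /sqmod lee_fin sqr_ge0. Qed.

Lemma l2_predE (R : realType) (X : choiceType) (f : X -> R[i]) :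
  (f \in @l2_pred R X) = `[< (\esum_(x in setT) sqmod (f x) < +oo)%E >].
Proof.
rewrite inE /summable; congr asbool; congr (is_true (_ < _)%E).
by apply: eq_esum => x _; rewrite gee0_abs// sqmod_ge0.
Qed.

Lemma l2_submod (R : realType) (X : choiceType) :
  submod_closed (@l2_pred R X).
Proof.
split.
  rewrite l2_predE; apply/asboolP; rewrite esum1// => x _.
  by rewrite /sqmod /= /ComplexField.Normc.normc /= expr0n/= addr0 sqrtr0 expr0n.
move=> c f g; rewrite !l2_predE => /asboolP Hf /asboolP Hg; apply/asboolP.
pose k : R := 2 * (ComplexField.Normc.normc c) ^+ 2.
have k0 : 0 <= k by rewrite /k mulr_ge0// sqr_ge0.
apply: (@le_lt_trans _ _
    (\esum_(x in setT) (k%:E * sqmod (f x) + 2%:E * sqmod (g x)))%E).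
  apply: le_esum => x _.
  rewrite /sqmod -!EFinM -EFinD lee_fin /k.
  have -> : (c *: f + g) x = c * f x + g x by [].
  have := le_normcD (c * f x) (g x).
  rewrite ComplexField.Normc.normcM.
  set u := ComplexField.Normc.normc c; set v := ComplexField.Normc.normc (f x).
  set w := ComplexField.Normc.normc (g x).
  set n := ComplexField.Normc.normc (c * f x + g x) => nle.
  have n0 : 0 <= n.
    by rewrite /n /ComplexField.Normc.normc; case: (_ + _) => *; exact: sqrtr_ge0.
  have : n ^+ 2 <= (u * v + w) ^+ 2 by rewrite ler_pXn2r ?nnegrE// (le_trans n0).
  have := sqr_ge0 (u * v - w); rewrite !expr2; nra.
have sM (h : X -> R[i]) (l : R) : 0 <= l ->
    (\esum_(x in setT) sqmod (h x) < +oo)%E ->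
    (\esum_(x in setT) (l%:E * sqmod (h x)) < +oo)%E.
  move=> l0 Hh.
  apply: (@le_lt_trans _ _ (l%:E * \esum_(x in setT) sqmod (h x))%E).
    apply: ub_ereal_sup => _ [A fA <-].
    rewrite -ge0_mule_fsumr; last by move=> i; exact: sqmod_ge0.
    by rewrite lee_wpmul2l ?lee_fin//; apply: ereal_sup_ubound; exists A.
  by rewrite lte_mul_pinfty// lee_fin.
rewrite esumD => [||x _]; rewrite ?mule_ge0 ?sqmod_ge0 ?lee_fin//.
  by rewrite lte_add_pinfty ?sM.
by move=> x _; rewrite mule_ge0 ?sqmod_ge0 ?lee_fin.
Qed.

HB.instance Definition _ (R : realType) (X : choiceType) :=
  GRing.isSubmodClosed.Build R[i] (X -> R[i]) (@l2_pred R X)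
    (@l2_submod R X).

Record l2 (R : realType) (X : choiceType) := L2 {
  l2fun :> X -> R[i];
  l2funP : l2fun \in @l2_pred R X }.

HB.instance Definition _ (R : realType) (X : choiceType) :=
  [isSub for @l2fun R X].
HB.instance Definition _ (R : realType) (X : choiceType) :=
  [Choice of l2 R X by <:].
HB.instance Definition _ (R : realType) (X : choiceType) :=
  [SubChoice_isSubLmodule of l2 R X by <:].

Definition l2norm (R : realType) (X : choiceType) (f : l2 R X) : R :=
  Num.sqrt (fine (\esum_(x in setT) sqmod (f x))).

Lemma l2delta_subproof (R : realType) (X : choiceType) (x : X) :
  (fun y : X => (y == x)%:R : R[i]) \in @l2_pred R X.
Proof.
rewrite l2_predE; apply/asboolP.
rewrite (_ : \esum_(y in setT) _ = \esum_(y in [set x]) sqmod (1%R : R[i]))%E.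
  by rewrite esum_set1 ?sqmod_ge0// /sqmod ltry.
rewrite [RHS]esum_mkcond; apply: eq_esum => y _.
case: eqVneq => [->|yx]; first by rewrite mem_set.
rewrite memNset => [|/eqP]; last by rewrite (negbTE yx).
by rewrite /sqmod /ComplexField.Normc.normc /= expr0n/= addr0 sqrtr0 expr0n.
Qed.

Definition l2delta (R : realType) (X : choiceType) (x : X) : l2 R X :=
  L2 (@l2delta_subproof R X x).

Record bounded_op (R : realType) (X : choiceType) := BoundedOp {
  bop :> {linear l2 R X -> l2 R X};
  bopP : exists M : R, forall f, l2norm (bop f) <= M * l2norm f }.

Definition opnorm (R : realType) (X : choiceType) (T : l2 R X -> l2 R X) : R :=
  sup [set l2norm (T f) | f in [set f | l2norm f <= 1]].

Definition norm_closure (R : realType) (X : choiceType)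
    (A : set (bounded_op R X)) : set (bounded_op R X) :=
  [set T | forall e : R, 0 < e ->
     exists2 S, A S & opnorm (fun f => T f - S f) < e].

(* The coordinate of f at x is the inner product of delta_x and f. *)
Definition mx_entry (R : realType) (X : choiceType) (T : bounded_op R X)
    (x y : X) : R[i] :=
  T (l2delta R y) x.

(** * Uniform Roe algebras *)

Definition controlled_op (R : realType) (X : choiceType)
    (E : set (set (X * X))) : set (bounded_op R X) :=
  [set T | exists2 A, E A & forall x y, ~ A (x, y) -> mx_entry T x y = 0].

(* For a coarse structure E the controlled operators form a *-algebra, so that
   the C*-algebra they generate is their norm closure. *)
Definition uRoe (R : realType) (X : choiceType) (E : set (set (X * X))) :
    set (bounded_op R X) :=
  norm_closure (@controlled_op R X E).

Arguments uRoe R {X} E.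

Definition uRoe_ideal (R : realType) (X : choiceType)
    (F : set (coarse_class R X)) : set (bounded_op R X) :=
  norm_closure (\bigcup_(al in F) uRoe R (class_coarse al)).

(* Main.v *)
Require Import Defs.
From mathcomp Require Import all_boot all_classical all_reals.
From mathcomp Require Import all_order all_algebra all_analysis complex ring lra.

Set Implicit Arguments.
Unset Strict Implicit.
Unset Printing Implicit Defensive.

Import Order.TTheory GRing.Theory Num.Theory.

Local Open Scope classical_set_scope.
Local Open Scope ring_scope.

(** The classes in a nonempty ideal [F] are directed: as [a \/ b] is pointwise
    at most [a] and at most [b], the coarse structure of the join contains
    those of [a] and [b]. A directed union of coarse structures is a coarse
    structure, so the coarse structure generated by the [E_d] with [d] in [F]
    adds nothing to their union ([ideal_coarseE]). An operator controlled by
    this structure is therefore already controlled by a single class of [F]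
    ([controlled_op_bigcup]).

    Hence both algebras are built from the operators controlled by some class
    of [F], and differ only in that one of them takes the norm closure for
    every class before it takes the closure of the union. Closing twice is the
    same as closing once ([norm_closure_bigcup]), by the triangle inequality for
    the operator norm. That inequality comes from the one in [l_2(X)]
    ([l2norm_add_le]), which is obtained by summing a weighted convexity
    inequality for squares ([sqr_addr_le]) over the coordinates. *)

(** * The coarse structure generated by an ideal *)

(** A smaller metric has larger balls, so the order is reversed; this is why
    joins of metrics, which are infima, enlarge coarse structures. *)
Lemma sub_metric_coarse (R : realType) (X : Type) (a b : X -> X -> R) :
  (forall x y, b x y <= a x y) -> metric_coarse a `<=` metric_coarse b.
Proof.
by move=> ba A [r r0 Ar]; exists r => // xy /Ar; exact: le_trans.
Qed.

Lemma metric_coarse_structure (R : realType) (X : Type) (d : X -> X -> R) :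
  is_metric d -> coarse_structure (metric_coarse d).
Proof.
move=> [_ d0 dC dD]; split.
- exists 1 => // -[x y] /= xy.
  by rewrite /entourage_le /= (_ : d x y = 0)//; apply/d0.
- by move=> A B AB [r r0 Br]; exists r => //; exact: subset_trans Br.
- move=> A B [r r0 Ar] [s s0 Bs]; exists (Num.max r s).
    by rewrite lt_max r0.
  by move=> xy [/Ar|/Bs]; rewrite /entourage_le /= le_max => ->;
    rewrite ?orbT.
- move=> A [r r0 Ar]; exists r => // -[x y] /= /Ar.
  by rewrite /entourage_le /= dC.
- move=> A B [r r0 Ar] [s s0 Bs]; exists (r + s); first exact: addr_gt0.
  move=> [x z] /= [y /= xy yz]; apply: (le_trans (dD x y z)).
  by apply: lerD; [exact: (Ar (x, y))|exact: (Bs (y, z))].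
Qed.

(** Unions and compositions involve two entourages at once; directedness places
    them in a common [E k], where the closure property is available. *)
Lemma directed_coarse_structure (X I : Type) (D : set I)
    (E : I -> set (set (X * X))) :
  D !=set0 -> (forall i, D i -> coarse_structure (E i)) ->
  (forall i j, D i -> D j ->
     exists2 k, D k & E i `<=` E k /\ E j `<=` E k) ->
  coarse_structure (\bigcup_(i in D) E i).
Proof.
move=> [i0 Di0] EP dirE; split.
- by exists i0 => //; have [] := EP _ Di0.
- move=> A B AB [i Di iB]; exists i => //.
  by have [_ sub _ _ _] := EP _ Di; exact: sub iB.
- move=> A B [i Di iA] [j Dj jB]; have [k Dk [ik jk]] := dirE _ _ Di Dj.
  exists k => //; have [_ _ cupE _ _] := EP _ Dk.
  by apply: cupE; [exact: ik|exact: jk].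
- move=> A [i Di iA]; exists i => //.
  by have [_ _ _ invE _] := EP _ Di; exact: invE.
- move=> A B [i Di iA] [j Dj jB]; have [k Dk [ik jk]] := dirE _ _ Di Dj.
  exists k => //; have [_ _ _ _ compE] := EP _ Dk.
  by apply: compE; [exact: ik|exact: jk].
Qed.

(** Closure under joins makes the family directed, so that its union is already
    the smallest coarse structure containing it. *)
Lemma ideal_coarseE (R : realType) (X : Type) (F : set (coarse_class R X)) :
  (forall al be, F al -> F be -> F (cjoin al be)) -> F !=set0 ->
  ideal_coarse F = \bigcup_(al in F) class_coarse al.
Proof.
move=> joinF F0.
have -> : \bigcup_(al in F) class_coarse al =
    \bigcup_(d in [set d : udmetric R X | F (cclass d)]) metric_coarse d.
  apply/seteqP; split=> A [].
    move=> al Fal alA; exists (generic_quotient.repr al) => //=.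
    by rewrite repr_cclass.
  by move=> d Fd dA; exists (cclass d) => //; rewrite class_coarse_cclass.
apply/seteqP; split; last exact: sub_gen_smallest.
apply: smallest_sub => //; apply: directed_coarse_structure.
- have [al Fal] := F0; exists (generic_quotient.repr al).
  by rewrite /= repr_cclass.
- by move=> d _; apply/metric_coarse_structure/udist_metric.
- move=> a b /= Fa Fb; exists (join_metric a b).
    by rewrite /= -cjoin_cclass; exact: joinF.
  by split; apply: sub_metric_coarse => x y;
    apply: (le_trans (join_dist_le_step a b x y)); rewrite ge_min lexx ?orbT.
Qed.

Lemma controlled_op_bigcup (R : realType) (X : choiceType) (I : Type)
    (D : set I) (E : I -> set (set (X * X))) :
  @controlled_op R X (\bigcup_(i in D) E i) =
  \bigcup_(i in D) @controlled_op R X (E i).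
Proof.
apply/seteqP; split=> T.
  by move=> [A [i Di iA] TA]; exists i => //; exists A.
by move=> [i Di [A iA TA]]; exists A => //; exists i.
Qed.

(** * The norm of l_2(X) *)

Section L2Norm.
Context (R : realType) (X : choiceType).
Implicit Types (f g : l2 R X) (a b : R).

Lemma l2norm_ge0 f : 0 <= l2norm f.
Proof. exact: sqrtr_ge0. Qed.

Lemma sqr_l2norm f : (l2norm f ^+ 2)%:E = (\esum_(x in setT) sqmod (f x))%E.
Proof.
have s0 : (0 <= \esum_(x in setT) sqmod (f x))%E.
  by apply: esum_ge0 => x _; exact: sqmod_ge0.
rewrite /l2norm sqr_sqrtr ?fine_ge0// fineK// ge0_fin_numE//.
by have := l2funP f; rewrite l2_predE => /asboolP.
Qed.

Lemma l2normN f : l2norm (- f) = l2norm f.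
Proof.
congr (Num.sqrt (fine _)); apply: eq_esum => x _.
by rewrite /sqmod -[(- f) x]/(- f x); case: (f x) => u v /=; rewrite !sqrrN.
Qed.

Lemma l2norm0 : l2norm (0 : l2 R X) = 0.
Proof.
rewrite /l2norm esum1 ?sqrtr0// => x _.
by rewrite /sqmod /= expr0n /= addr0 sqrtr0 expr0n.
Qed.

Lemma normc_ge0 (z : R[i]) : 0 <= ComplexField.Normc.normc z.
Proof. by case: z => u v; exact: sqrtr_ge0. Qed.

Lemma esum_scale_le a (h : X -> \bar R) : 0 <= a -> (forall x, 0 <= h x)%E ->
  (\esum_(x in setT) (a%:E * h x) <= a%:E * \esum_(x in setT) h x)%E.
Proof.
move=> a0 h0; apply: ge_ereal_sup => _ [A fA <-].
rewrite -ge0_mule_fsumr//.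
by rewrite lee_wpmul2l ?lee_fin//; apply: ereal_sup_ubound; exists A.
Qed.

(** Convexity of the square for the weights [a / (a + b)] and [b / (a + b)]. *)
Lemma sqr_addr_le (u v a b : R) : 0 < a -> 0 < b ->
  (u + v) ^+ 2 <= (a + b) / a * u ^+ 2 + (a + b) / b * v ^+ 2.
Proof.
move=> a0 b0; rewrite -subr_ge0.
have -> : (a + b) / a * u ^+ 2 + (a + b) / b * v ^+ 2 - (u + v) ^+ 2 =
    (b * u - a * v) ^+ 2 / (a * b).
  by field; rewrite !gt_eqF.
by rewrite divr_ge0 ?sqr_ge0 ?mulr_ge0 ?ltW.
Qed.

(** The triangle inequality, in terms of strictly positive bounds: these serve
    as weights in [sqr_addr_le], which then gives
    [|f + g|^2 <= (a + b) (|f|^2 / a + |g|^2 / b) <= (a + b)^2]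
    without any use of the Cauchy-Schwarz inequality, and with no special
    treatment of vectors of norm zero. *)
Lemma l2norm_add_le f g a b : 0 < a -> 0 < b ->
  l2norm f <= a -> l2norm g <= b -> l2norm (f + g) <= a + b.
Proof.
move=> a0 b0 fa gb; have ab0 : 0 < a + b by exact: addr_gt0.
rewrite -(@ler_pXn2r _ 2)// ?nnegrE ?l2norm_ge0 ?(ltW ab0)//.
rewrite -lee_fin sqr_l2norm.
have ca : 0 < (a + b) / a by exact: divr_gt0.
have cb : 0 < (a + b) / b by exact: divr_gt0.
apply: (@le_trans _ _ (\esum_(x in setT)
    (((a + b) / a)%:E * sqmod (f x) + ((a + b) / b)%:E * sqmod (g x)))%E).
  apply: le_esum => x _; rewrite /sqmod -!EFinM -EFinD lee_fin.
  apply: le_trans (sqr_addr_le _ _ a0 b0).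
  by rewrite ler_pXn2r// ?nnegrE ?addr_ge0 ?normc_ge0 ?le_normcD.
rewrite esumD; last 2 first.
- by move=> x _; rewrite mule_ge0 ?sqmod_ge0 ?lee_fin ?ltW.
- by move=> x _; rewrite mule_ge0 ?sqmod_ge0 ?lee_fin ?ltW.
apply: (le_trans (leeD (esum_scale_le (ltW ca) (fun x => sqmod_ge0 (f x)))
  (esum_scale_le (ltW cb) (fun x => sqmod_ge0 (g x))))).
rewrite -!sqr_l2norm -!EFinM -EFinD lee_fin.
have -> : (a + b) ^+ 2 = (a + b) / a * a ^+ 2 + (a + b) / b * b ^+ 2.
  by field; rewrite !gt_eqF.
by rewrite lerD// ler_pM2l// ler_pXn2r// nnegrE ?l2norm_ge0 ?ltW.
Qed.

End L2Norm.

(** * Norm closures *)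

Section NormClosure.
Context (R : realType) (X : choiceType).
Implicit Types (S T U : bounded_op R X) (e : R).

Lemma opnorm_le (T : l2 R X -> l2 R X) e :
  (forall f, l2norm f <= 1 -> l2norm (T f) <= e) -> opnorm T <= e.
Proof.
move=> Te; apply: ge_sup; last by move=> _ [f /Te f1 <-].
by exists (l2norm (T 0)), 0; rewrite //= l2norm0.
Qed.

Lemma bounded_op_le T : exists2 M, 0 < M & forall f, l2norm f <= 1 ->
  l2norm (T f) <= M.
Proof.
have [M TM] := bopP T; exists (`|M| + 1); first by rewrite ltr_wpDl.
move=> f f1; apply: (le_trans (TM f)); apply: ler_wpDr => //.
apply: (@le_trans _ _ (`|M| * l2norm f)).
  by rewrite ler_wpM2r ?l2norm_ge0 ?ler_norm.
by rewrite ler_piMr.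
Qed.

(** The operator norm is a supremum of reals, hence meaningful only for a set
    bounded above; boundedness of the two operators provides the bound. *)
Lemma l2norm_le_opnorm S T f : l2norm f <= 1 ->
  l2norm (T f - S f) <= opnorm (fun g => T g - S g).
Proof.
move=> f1; apply: ub_le_sup; last by exists f.
have [M M0 TM] := bounded_op_le T; have [N N0 SN] := bounded_op_le S.
by exists (M + N) => _ [g g1 <-]; apply: l2norm_add_le; rewrite ?l2normN; auto.
Qed.

(** The triangle inequality in the form that closures use. Two thirds of [e]
    rather than two halves leave room for the loss of strictness in passing
    through the supremum. *)
Lemma opnorm_sub_lt S T U e :
  opnorm (fun f => T f - S f) < e / 3 -> opnorm (fun f => S f - U f) < e / 3 ->
  opnorm (fun f => T f - U f) < e.
Proof.
move=> TS SU; have e0 : 0 < e / 3.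
  (* An operator norm is nonnegative: it is at least the value at 0. *)
  apply: le_lt_trans TS; apply: le_trans (l2norm_le_opnorm S T (f := 0) _).
    exact: l2norm_ge0.
  by rewrite l2norm0.
apply: (@le_lt_trans _ _ (e / 3 + e / 3)); last by lra.
apply: opnorm_le => f f1; rewrite -(subrKA (S f)).
by apply: l2norm_add_le => //; apply/ltW;
  [apply: le_lt_trans TS|apply: le_lt_trans SU]; exact: l2norm_le_opnorm.
Qed.

Lemma sub_norm_closure (A : set (bounded_op R X)) : A `<=` norm_closure A.
Proof.
move=> T AT e e0; exists T => //; apply: le_lt_trans e0; apply: opnorm_le.
by move=> f _; rewrite subrr l2norm0.
Qed.

(** The union of the closures need not be closed, but it lies between the union
    and its closure, which is idempotent. *)
Lemma norm_closure_bigcup (I : Type) (D : set I)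
    (A : I -> set (bounded_op R X)) :
  norm_closure (\bigcup_(i in D) norm_closure (A i)) =
  norm_closure (\bigcup_(i in D) A i).
Proof.
apply/seteqP; split=> T clT e e0.
  have e3 : 0 < e / 3 by rewrite divr_gt0.
  have [S [i Di clS] TS] := clT _ e3; have [U AU SU] := clS _ e3.
  by exists U; [exists i|exact: opnorm_sub_lt TS SU].
have [S [i Di AS] TS] := clT _ e0.
by exists S => //; exists i => //; exact: sub_norm_closure.
Qed.

End NormClosure.

Theorem proposition5p2 (R : realType) (X : choiceType)
    (F : set (coarse_class R X)) (idealF : is_ideal F) (F0 : (F !=set0)%classic) :
  uRoe_ideal F = uRoe R (ideal_coarse F).
Proof.
have [_ joinF] := idealF.
rewrite /uRoe_ideal /uRoe norm_closure_bigcup.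
by rewrite -controlled_op_bigcup -ideal_coarseE.
Qed.
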